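(* Let $G$ be a connected graph with minimum degree at least $2$, and let $Q\in\mathbb{R}^{k\times k}$ be an orthogonal matrix with no integral rows. Suppose that there is a graph $H$ not isomorphic to $G$ that is obtained from $G$ by a $Q$-switching. Then $G$ has a connected subgraph with at most $2k+1$ vertices and strictly more edges than vertices.
   Context: Graphs are finite and simple, on vertex set $V$ with $|V|=n\ge k$. A row of a matrix is integral if all its entries are integers. $Q$-switching: a graph $H$ (on the same vertex set) is obtained from $G$ by a $Q$-switching with switching set $X\subseteq V$, $|X|=k$, if after ordering the vertices with $X$ first, $A_H=M^{T}A_GM$ where $M=\operatorname{diag}(Q,-I_a,I_b)$ is block diagonal with $a+b=n-k$ and $A_G,A_H$ are the adjacency matrices. *)

(* Defs.v *)
From HB Require Import structures.
From mathcomp Require Import all_boot all_order all_algebra all_fingroup.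
From mathcomp Require Import reals.
Set Implicit Arguments. Unset Strict Implicit. Unset Printing Implicit Defensive.
Import Order.TTheory GRing.Theory Num.Theory.
Local Open Scope ring_scope.

Definition simple_graph (n : nat) (g : rel 'I_n) : Prop :=
  symmetric g /\ irreflexive g.

Definition adjmx (R : pzRingType) (n : nat) (g : rel 'I_n) : 'M[R]_n :=
  \matrix_(i, j) (g i j)%:R.

Definition graph_iso (n : nat) (g h : rel 'I_n) : Prop :=
  exists s : 'S_n, forall i j, h (s i) (s j) = g i j.

Definition connected_graph (n : nat) (g : rel 'I_n) : Prop :=
  forall u v, connect g u v.

Definition degree (n : nat) (g : rel 'I_n) (v : 'I_n) : nat := #|[set u | g v u]|.

Definition edges (n : nat) (g : rel 'I_n) : {set {set 'I_n}} :=
  [set [set u; v] | u in 'I_n, v in 'I_n & g u v].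

Definition connected_subgraph (n : nat) (g : rel 'I_n)
    (S : {set 'I_n}) (F : {set {set 'I_n}}) : Prop :=
  [/\ F \subset edges g,
      (forall e, e \in F -> e \subset S),
      S != set0 &
      (forall u v, u \in S -> v \in S ->
         connect (fun x y => [set x; y] \in F) u v)].

Definition integral_row (R : realType) (k : nat) (Q : 'M[R]_k) (i : 'I_k) : Prop :=
  forall j, exists z : int, Q i j = z%:~R.

Definition orthogonal_mx (R : realType) (k : nat) (Q : 'M[R]_k) : Prop :=
  Q *m Q^T = 1%:M.

(* The switching matrix, written in the original vertex order: the switching
   set X is the image of the injective enumeration e : 'I_k -> 'I_n (this
   enumeration is the chosen ordering of X, placed first), on X x X the matrix
   is Q, outside X it is diagonal with entries -1 (s u = true) or 1. This is
   the matrix diag(Q, -I_a, I_b) conjugated back to the original ordering. *)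
Definition switch_mx (R : realType) (n k : nat) (Q : 'M[R]_k)
    (e : 'I_k -> 'I_n) (s : 'I_n -> bool) : 'M[R]_n :=
  \matrix_(u, v)
    match [pick i | e i == u], [pick j | e j == v] with
    | Some i, Some j => Q i j
    | None, None => if u == v then (if s u then -1 else 1) else 0
    | _, _ => 0
    end.

Definition Q_switching (R : realType) (n k : nat) (Q : 'M[R]_k)
    (g h : rel 'I_n) : Prop :=
  exists (e : 'I_k -> 'I_n) (s : 'I_n -> bool),
    injective e /\
    adjmx R h = (switch_mx Q e s)^T *m adjmx R g *m switch_mx Q e s.

(* Main.v *)
(* Assume that G has no such subgraph. A vertex y outside the switching set X
   cannot have exactly one neighbour x in X, since its row in A_H would then be
   plus or minus row x of Q. Growing a connected set from x in X, each time by a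
   neighbour in X or by an outside vertex together with a new vertex of X, one
   finds that every x in X has degree 2 and every outside vertex adjacent to X
   has exactly two neighbours in X. Hence the edges of G meeting X form disjoint
   cycles on a set P, and comparing quadratic forms shows the same for H, on the
   same P.

   Put T_0 = 2 I_P, T_1 = A and T_(m+2) = A T_(m+1) - T_m. On a union of cycles,
   T_m(u,v) counts the directions in which v is m steps away from u. The
   switching conjugates the T_m of G to those of H and only changes signs outside
   X, so vertices outside X are at the same distances along the cycles of G and
   of H. These distances determine a finite subset of a cycle up to a dihedral
   symmetry, so G and H are isomorphic by a map fixing every vertex outside X. If
   instead some cycle of G lies inside X, then G is this cycle, and the traces of
   the T_m show that H is a cycle of the same length. *)
Require Import Defs.
From HB Require Import structures.
From mathcomp Require Import all_boot all_order all_algebra all_fingroup.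
From mathcomp Require Import reals zify ring lra.
Import Order.TTheory GRing.Theory Num.Theory.

Set Implicit Arguments.
Unset Strict Implicit.

Local Open Scope nat_scope.

(** * Dense subgraphs near the switching set *)

Section DenseSubgraphs.
Variables (n : nat) (g : rel 'I_n).
Hypotheses (gsym : symmetric g) (girr : irreflexive g).
Implicit Types (S : {set 'I_n}) (u v w z : 'I_n).

Definition deg_in S u := \sum_(v in S) (g u v : nat).
Definition deg_sum S := \sum_(u in S) deg_in S u.
Definition induced S := [rel u v | [&& u \in S, v \in S & g u v]].
Definition induced_connected S :=
  [forall u in S, forall v in S, connect (induced S) u v].

Lemma deg_inE S u : deg_in S u = #|[set v in S | g u v]|.
Proof.
by rewrite -sum1dep_card big_mkcondr; apply: eq_bigr => v _; case: (g u v).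
Qed.

Lemma deg_in_le S1 S2 u :
  (forall v, v \in S1 -> g u v -> v \in S2) -> deg_in S1 u <= deg_in S2 u.
Proof.
move=> S12; rewrite !deg_inE; apply/subset_leq_card/subsetP => v.
by rewrite !inE => /andP[vS uv]; rewrite S12.
Qed.

Lemma deg_inS S1 S2 u : S1 \subset S2 -> deg_in S1 u <= deg_in S2 u.
Proof. by move=> /subsetP S12; apply: deg_in_le => v /S12. Qed.

Lemma deg_in_gt0 S u v : v \in S -> g u v -> 0 < deg_in S u.
Proof. by move=> vS uv; rewrite deg_inE; apply/card_gt0P; exists v; rewrite inE vS. Qed.

Lemma deg_in_gt0P S u : reflect (exists2 v, v \in S & g u v) (0 < deg_in S u).
Proof.
rewrite deg_inE; apply: (iffP card_gt0P) => -[v].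
  by rewrite inE => /andP[]; exists v.
by move=> vS uv; exists v; rewrite inE vS.
Qed.

Lemma deg_sumU1 S z : z \notin S -> deg_sum (z |: S) = deg_sum S + 2 * deg_in S z.
Proof.
move=> zS.
have degU u : deg_in (z |: S) u = (g u z : nat) + deg_in S u.
  by rewrite {1}/deg_in big_setU1.
rewrite /deg_sum big_setU1 //= degU girr add0n (eq_bigr _ (fun u _ => degU u)).
rewrite big_split /= (eq_bigr (fun u => g z u : nat)) => [|u _]; last by rewrite gsym.
by rewrite -/(deg_in S z); lia.
Qed.

Lemma induced_sym S : symmetric (induced S).
Proof. by move=> u v; rewrite /= gsym andbCA. Qed.

Lemma induced_connected_root S u :
  (forall v, v \in S -> connect (induced S) u v) -> induced_connected S.
Proof.
move=> uS; apply/forall_inP => v vS; apply/forall_inP => w wS.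
have sym := sym_connect_sym (induced_sym S).
by apply: connect_trans (uS w wS); rewrite sym uS.
Qed.

Lemma induced_connectedU1 S z w :
  induced_connected S -> w \in S -> g z w -> induced_connected (z |: S).
Proof.
move=> Sc wS zw; apply: (@induced_connected_root _ w) => v /setU1P[->|vS].
  by apply: connect1; rewrite /= !inE eqxx wS orbT gsym zw.
have /connectP[p wp ->] := forall_inP (forall_inP Sc w wS) v vS.
apply/connectP; exists p => //; apply: sub_path wp => a b /=.
by rewrite !inE => /and3P[-> -> ->]; rewrite !orbT.
Qed.

(** [deg_sum S] counts ordered adjacent pairs, and at most two of them, [(a, b)] and [(b, a)], have
    the same set of ends. *)
Lemma deg_sum_le_edges S :
  deg_sum S <= 2 * #|[set e in edges g | e \subset S]|.
Proof.
set E := [set e in _ | _].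
pose D := [set p : 'I_n * 'I_n | [&& p.1 \in S, p.2 \in S & g p.1 p.2]].
pose ends (p : 'I_n * 'I_n) := [set p.1; p.2].
have -> : deg_sum S = #|D|.
  rewrite -sum1dep_card /deg_sum /deg_in pair_big_dep /= big_mkcond [RHS]big_mkcond /=.
  by apply: eq_bigr => -[u v] _ /=; case: (u \in S); case: (v \in S); case: (g u v).
have DE p : p \in D -> ends p \in E.
  case: p => u v; rewrite !inE /= => /and3P[uS vS uv]; apply/andP; split.
    by apply/imset2P; exists u v; rewrite ?inE.
  by rewrite subUset !sub1set uS.
rewrite -sum1_card (partition_big ends (mem E)) //= mulnC -sum_nat_const.
apply: leq_sum => e _; rewrite sum1dep_card.
set P := [set _ | _]; have [->|[[a b]]] := set_0Vmem P; first by rewrite cards0.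
rewrite !inE /ends /= => /andP[/and3P[_ _ ab] /eqP eab].
apply: leq_trans (subset_leq_card (B := [set (a, b); (b, a)]) _) _; last first.
  by rewrite cards2; case: eqP.
apply/subsetP => -[u v]; rewrite !inE /= -eab => /andP[/and3P[_ _ uv] /eqP euv].
have : u \in [set a; b] by rewrite -euv !inE eqxx.
have : v \in [set a; b] by rewrite -euv !inE eqxx orbT.
move: uv; rewrite !inE !xpair_eqE => uv /orP[]/eqP vE /orP[]/eqP uE.
all: by move: uv; rewrite vE uE ?girr ?eqxx ?orbT.
Qed.

Lemma dense_connected_subgraph S :
  S != set0 -> induced_connected S -> 2 * #|S| < deg_sum S ->
  exists F, connected_subgraph g S F /\ #|S| < #|F|.
Proof.
move=> S0 Sc dense; exists [set e in edges g | e \subset S]; split; last first.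
  by have := leq_trans dense (deg_sum_le_edges S); rewrite ltn_mul2l.
split=> // [|e|u v uS vS].
- by apply/subsetP => e; rewrite inE => /andP[].
- by rewrite inE => /andP[].
apply: connect_sub (forall_inP (forall_inP Sc u uS) v vS) => a b /= /and3P[aS bS ab].
apply: connect1; rewrite inE subUset !sub1set aS bS !andbT.
by apply/imset2P; exists a b; rewrite ?inE.
Qed.

Variables (X : {set 'I_n}).
Hypothesis mindeg : forall v, 2 <= deg_in [set: 'I_n] v.
Hypothesis degX : forall y, y \notin X -> 0 < deg_in X y -> 2 <= deg_in X y.

(* The bound on [S :\: X] keeps [S] below [2k] vertices. The one on [deg_sum],
   twice the number of edges, holds for every connected set; carrying it along
   saves proving this. *)
Let thin x0 S := [&& x0 \in S, induced_connected S, #|S :\: X| < #|S :&: X|,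
   2 * #|S| <= deg_sum S + 2 & [forall u in S :\: X, 0 < deg_in (S :&: X) u]].

Let thinU1_in x0 S w z : thin x0 S -> w \in X -> w \notin S -> z \in S -> g w z ->
  thin x0 (w |: S).
Proof.
case/and5P=> xS Sc card dS /forall_inP dX wX wS zS wz.
have EI : (w |: S) :&: X = w |: (S :&: X).
  by apply/setP => u; rewrite !inE; case: eqP => [->|].
have ED : (w |: S) :\: X = S :\: X.
  by apply/setP => u; rewrite !inE; case: eqP => [->|]; rewrite ?wX.
have dw := deg_in_gt0 zS wz.
apply/and5P; split.
- by rewrite inE xS orbT.
- exact: induced_connectedU1 wz.
- by rewrite ED EI (leq_trans card) // subset_leq_card // subsetUr.
- by rewrite deg_sumU1 // cardsU1 wS; lia.
rewrite ED EI; apply/forall_inP => u /dX; move/leq_trans; apply.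
by rewrite deg_inS // subsetUr.
Qed.

(** The parts of [S] inside and outside [X] both grow by one, which keeps the strict inequality, and
    the two new vertices bring at least two edges. *)
Let thinU2 x0 S x y x' : thin x0 S -> x \in S :&: X -> x' \in X -> x' \notin S ->
  y \notin X -> y \notin S -> g y x -> g y x' -> thin x0 (x' |: (y |: S)).
Proof.
case/and5P=> xS Sc card dS /forall_inP dX /setIP[x1S x1X] x'X x'S yX yS yx yx'.
have x'y : x' != y by apply: contraNneq yX => <-.
have x'yS : x' \notin y |: S by rewrite !inE negb_or x'y.
have EI : (x' |: (y |: S)) :&: X = x' |: (S :&: X).
  apply/setP => u; rewrite !inE; case: eqP => [->|] //=.
  by case: eqP => [->|] //=; rewrite (negbTE yX) (negbTE yS).
have ED : (x' |: (y |: S)) :\: X = y |: (S :\: X).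
  apply/setP => u; rewrite !inE; case: eqP => [->|] //=.
    by rewrite (negbTE x'y) x'X.
  by case: eqP => [->|] //=; rewrite yX.
have yc := induced_connectedU1 Sc x1S yx.
have yS1 : y \in y |: S by rewrite setU11.
have dy := deg_in_gt0 x1S yx; rewrite gsym in yx'.
have dx' := deg_in_gt0 yS1 yx'.
apply/and5P; split.
- by rewrite !inE xS !orbT.
- exact: induced_connectedU1 yx'.
- by rewrite ED EI !cardsU1 !inE (negbTE yS) (negbTE x'S) andbF ltn_add2l.
- by rewrite !deg_sumU1 // !cardsU1 x'yS yS; move: dS dy dx'; clear; lia.
rewrite ED EI; apply/forall_inP => u /setU1P[->|/dX du].
  by apply: deg_in_gt0 yx; rewrite !inE x1S x1X orbT.
by apply: leq_trans du _; rewrite deg_inS // subsetUr.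
Qed.

(** A maximal thin [S] admits neither extension, so adding all outside vertices adjacent to
    [S :&: X] gives a set [T] in which every degree is at least 2. If [T] has two vertices not in
    [S], then [S] with these two is dense. Otherwise [T] has at most [2 * k] vertices and is dense
    or 2-regular. *)
Lemma dense_or_regular x0 k : #|X| <= k -> x0 \in X ->
  (exists S, [/\ S != set0, induced_connected S, 2 * #|S| < deg_sum S & #|S| <= 2 * k + 1])
  \/ (deg_in [set: 'I_n] x0 = 2 /\ forall y, y \notin X -> g y x0 -> deg_in X y = 2).
Proof.
move=> Xk x0X; have thin0 : thin x0 [set x0].
  have ED : [set x0] :\: X = set0.
    by apply/setP => u; rewrite !inE; case: eqP => [->|]; rewrite ?x0X ?andbF.
  have EI : [set x0] :&: X = [set x0] by apply/setIidPl; rewrite sub1set.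
  rewrite /thin EI ED set11 cards0 cards1 leq_addl /=; apply/andP; split.
    by apply: (@induced_connected_root _ x0) => v /set1P->.
  by apply/forall_inP => u; rewrite inE.
have [S /maxsetP[St Smax] _] := maxset_exists thin0.
have closedX w z : w \in X -> z \in S -> g w z -> w \in S.
  move=> wX zS wz; apply/negPn/negP => wS; move: (wS).
  by rewrite -(Smax _ (thinU1_in St wX wS zS wz)) ?setU11 ?subsetUr.
have closedY y x x' : y \notin X -> x \in S :&: X -> g y x ->
    x' \in X -> g y x' -> x' \in S.
  move=> yX xSX yx x'X yx'; case: (boolP (y \in S)) => [yS|yS].
    by apply: closedX yS _; rewrite // gsym.
  apply/negPn/negP => x'S; move: (x'S).
  rewrite -(Smax _ (thinU2 St xSX x'X x'S yX yS yx yx')) ?setU11 //.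
  by rewrite setUA subsetUr.
have /and5P[x0S Sc card dS /forall_inP dX] := St.
(* This bound leaves room for two more vertices; [0 < k] keeps the truncated subtraction exact. *)
have Sk : #|S| <= 2 * k - 1 /\ 0 < k.
  have := subset_leq_card (subsetIr S X); have := cardsID X S.
  by move: card Xk; clear; lia.
pose T := S :|: [set y in ~: X | 0 < deg_in (S :&: X) y].
have TX u : u \in T -> u \notin X -> 0 < deg_in (S :&: X) u.
  by rewrite !inE => /orP[uS uX|/andP[_ ->] //]; apply: dX; rewrite inE uS uX.
have TinX u : u \in T -> u \in X -> u \in S.
  by rewrite !inE => /orP[//|/andP[/negbTE->]].
have degTX u : u \in T -> u \in X -> deg_in [set: 'I_n] u <= deg_in T u.
  move=> uT uX; apply: deg_in_le => v _ uv; have uS := TinX u uT uX.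
  case: (boolP (v \in X)) => vX; rewrite inE; first by rewrite (closedX v u) // gsym.
  by apply/orP; right; rewrite !inE vX (deg_in_gt0 (v := u)) ?inE ?uS // gsym.
have degTY u : u \in T -> u \notin X -> deg_in X u <= deg_in T u.
  move=> uT uX; have /deg_in_gt0P[x xSX ux] := TX u uT uX.
  by apply: deg_in_le => v vX uv; rewrite inE (closedY u x v).
have degT u : u \in T -> 2 <= deg_in T u.
  move=> uT; case: (boolP (u \in X)) => uX.
    exact: leq_trans (mindeg u) (degTX u uT uX).
  apply: leq_trans (degTY u uT uX); apply: degX => //.
  by apply: leq_trans (TX u uT uX) _; rewrite deg_inS ?subsetIr.
have TDS y : y \in T :\: S -> [/\ y \notin S, 2 <= deg_in S y & exists2 w, w \in S & g y w].
  rewrite inE => /andP[yS yT]; have yX : y \notin X.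
    by apply: contra yS; apply: TinX.
  have /deg_in_gt0P[x xSX yx] := TX y yT yX.
  split=> //; last by exists x => //; case/setIP: xSX.
  apply: leq_trans (degX yX _) _; first by case/setIP: xSX => _ xX; apply: deg_in_gt0 yx.
  by apply: deg_in_le => v vX yv; apply: (closedY y x).
(* Two vertices with two neighbours each in [S] raise [deg_sum] by at least 8, from at least
   [2 * #|S| - 2] to more than [2 * (#|S| + 2)]. *)
have [/card_gt1P[y1 [y2 [y1T y2T y12]]]|TS] := ltnP 1 #|T :\: S|.
  left; have [y1S d1 [w1 w1S yw1]] := TDS _ y1T; have [y2S d2 [w2 w2S yw2]] := TDS _ y2T.
  have c1 := induced_connectedU1 Sc w1S yw1.
  have y2S1 : y2 \notin y1 |: S by rewrite !inE negb_or eq_sym y12.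
  exists (y2 |: (y1 |: S)); split.
  - by apply/set0Pn; exists y2; rewrite setU11.
  - by apply: induced_connectedU1 c1 _ yw2; rewrite inE w2S orbT.
  - have := deg_inS y2 (subsetUr [set y1] S).
    by rewrite !deg_sumU1 // !cardsU1 y1S y2S1; move: d1 d2 dS; clear; lia.
  - by rewrite !cardsU1 y1S y2S1; move: Sk; clear; lia.
have [Tc Tk] : induced_connected T /\ #|T| <= 2 * k.
  have ST : S \subset T by apply: subsetUl.
  have ET : T = S :|: (T :\: S) by rewrite setDE setUIr setUCr setIT; apply/esym/setUidPr.
  move: TS; rewrite leq_eqVlt ltnS leqn0 => /orP[/cards1P[y ey]|]; last first.
    by rewrite cards_eq0 => /eqP e; rewrite ET e setU0; split=> //; move: Sk; clear; lia.
  have [yS _ [w wS yw]] : [/\ y \notin S, _ & _] := TDS y ltac:(by rewrite ey set11).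
  rewrite ET ey setUC; split; first exact: induced_connectedU1 yw.
  by rewrite cardsU1 yS; move: Sk; clear; lia.
have [dense|sparse] := ltnP (2 * #|T|) (deg_sum T).
  left; exists T; split=> //; last by rewrite (leq_trans Tk) ?leq_addr.
  by apply/set0Pn; exists x0; rewrite inE x0S.
(* The degrees in [T] are all at least 2 and are at most 2 on average. *)
have degT2 u : u \in T -> deg_in T u <= 2.
  move=> uT; move: sparse; rewrite /deg_sum (big_setD1 u) //= (cardsD1 u) uT.
  have : \sum_(v in T :\ u) 2 <= \sum_(v in T :\ u) deg_in T v.
    by apply: leq_sum => v /setD1P[_ /degT].
  by rewrite sum_nat_const; move: (\sum_(v in _) _) (deg_in T u) #|_| => *; lia.
have x0T : x0 \in T by rewrite inE x0S.
right; split=> [|y yX yx0].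
  by apply/eqP; rewrite eqn_leq mindeg andbT (leq_trans (degTX _ x0T x0X)) ?degT2.
have yT : y \in T.
  by rewrite !inE yX (deg_in_gt0 (v := x0)) ?orbT // inE x0S.
apply/eqP; rewrite eqn_leq (leq_trans (degTY _ yT yX)) ?degT2 //.
by apply: degX => //; apply: deg_in_gt0 yx0.
Qed.

End DenseSubgraphs.

(** * Graphs whose nonisolated vertices have degree 2 *)

Section Orientation.
Variables (T : finType) (F : rel T).
Hypotheses (Fsym : symmetric F) (Firr : irreflexive F).
Hypothesis F2 : forall u v, F u v -> #|[set w | F u w]| = 2.

Let oth v u := odflt u [pick w | F v w && (w != u)].

Let othP v u : F v u ->
  [/\ F v (oth v u), oth v u != u & forall w, F v w -> w != u -> w = oth v u].
Proof.
move=> vu; have : #|[set w | F v w] :\ u| == 1.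
  by move/eqP: (F2 vu); rewrite (cardsD1 u) inE vu add1n eqSS.
case/cards1P=> x /setP Ex.
have xE w : F v w && (w != u) = (w == x) by have := Ex w; rewrite !inE andbC.
have -> : oth v u = x.
  rewrite /oth; case: pickP => [w|/(_ x)]; rewrite xE ?eqxx //.
  by move/eqP.
have /andP[-> ->] : F v x && (x != u) by rewrite xE.
by split=> // w vw wu; apply/eqP; rewrite -xE vw.
Qed.

(** A pair [d] with [F d.1 d.2] is a dart, and [next] walks on without turning back. Other pairs are
    fixed, so that [next] is a permutation of all of [T * T]. *)
Let next (d : T * T) := if F d.1 d.2 then (d.2, oth d.2 d.1) else d.
Let rv (d : T * T) := (d.2, d.1).

Let next_rv d : F d.1 d.2 -> next (rv (next d)) = rv d.
Proof.
case: d => u v /= uv; have vu : F v u by rewrite Fsym.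
have [vw wu] := othP vu; rewrite /next uv /= /rv /= Fsym vw => _.
congr (_, _); have [_ _ H] := othP vw; by rewrite -(H u) // eq_sym.
Qed.

Let F_next d : F (next d).1 (next d).2 = F d.1 d.2.
Proof.
rewrite /next; case: ifPn => [uv|/negbTE //] /=.
by have [] : [/\ F d.2 (oth d.2 d.1), oth d.2 d.1 != d.1 & _] := othP (etrans (Fsym _ _) uv).
Qed.

Let next_inj : injective next.
Proof.
move=> d d' dd'.
have E : F d.1 d.2 = F d'.1 d'.2 by rewrite -F_next dd' F_next.
case: (boolP (F d.1 d.2)) => [Fd|nFd]; last first.
  by move: dd'; rewrite /next -E (negbTE nFd).
have := next_rv Fd; rewrite dd' next_rv -?E //.
by case: d {dd' E Fd} => ? ?; case: d' => ? ? [-> ->].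
Qed.

Let N := perm next_inj.
Let NE d : N d = next d. Proof. exact: permE. Qed.

Let FN m d : F ((N ^+ m)%g d).1 ((N ^+ m)%g d).2 = F d.1 d.2.
Proof.
by elim: m => [|m IHm]; rewrite ?expg0 ?perm1 // expgSr permM NE F_next.
Qed.

Let N_rv m d : F d.1 d.2 -> (N ^+ m)%g (rv ((N ^+ m)%g d)) = rv d.
Proof.
elim: m d => [|m IHm] d Fd; first by rewrite !expg0 !perm1.
by rewrite {1}expgSr permM expgS permM IHm NE ?F_next // NE next_rv.
Qed.

(* A walk reaching the reverse of its first dart would have a dart in the
   middle that is its own reverse or is followed by its reverse. *)
Let rv_notin_porbit d : F d.1 d.2 -> rv d \notin porbit N d.
Proof.
move=> Fd; apply/porbitP => -[m dm].
pose e := (N ^+ m./2)%g d; have Fe : F e.1 e.2 by rewrite FN.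
have : (N ^+ m./2)%g (rv e) = (N ^+ m./2)%g ((N ^+ odd m)%g e).
  by rewrite N_rv // dm /e -!permM -!expgD addnCA addnn odd_double_half.
move/perm_inj; case: (odd m) => /=; last first.
  by rewrite expg0 perm1 /rv; case: e Fe => a b /= Fab [ba _]; rewrite ba Firr in Fab.
rewrite expg1 NE /next Fe /rv => -[e1].
by have [_ /eqP] := othP (etrans (Fsym _ _) Fe); rewrite -e1.
Qed.

(** Each cycle carries two orbits of darts, exchanged by [rv]; comparing their ranks chooses one
    direction on every cycle. *)
Let O d := enum_rank (porbit N d) < enum_rank (porbit N (rv d)).

Let O_rv d : F d.1 d.2 -> O (rv d) = ~~ O d.
Proof.
move=> Fd; have rvK : rv (rv d) = d by case: d {Fd}.
rewrite /O rvK ltn_neqAle -leqNgt; case: eqP => //= /val_inj/enum_rank_inj/eqP.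
by rewrite eq_sym eq_porbit_mem porbit_sym -[rv d \in _]negbK rv_notin_porbit.
Qed.

Let O_N d : F d.1 d.2 -> O (N d) = O d.
Proof.
move=> Fd; have NrvN : N (rv (N d)) = rv d by rewrite !NE next_rv.
have pN d' : porbit N (N d') = porbit N d'.
  by apply/eqP; rewrite eq_porbit_mem; apply/porbitP; exists 1; rewrite expg1.
by rewrite /O pN -(pN (rv (N d))) NrvN.
Qed.

Let O_oth u v : F u v -> O (v, oth v u) = O (u, v).
Proof. by move=> uv; rewrite -(@O_N (u, v)) // NE /next /= uv. Qed.

Let O_swap u v : F u v -> O (v, u) = ~~ O (u, v).
Proof. exact: (@O_rv (u, v)). Qed.

Let succ u := odflt u [pick v | F u v && O (u, v)].

Let succP u w : F u w -> F u (succ u) && O (u, succ u).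
Proof.
move=> uw; rewrite /succ; case: pickP => [//|none].
have wu : F w u by rewrite Fsym.
have nO : ~~ O (u, w) by have := none w; rewrite uw /= => ->.
have [uw' _ _] := othP uw.
(* If [(u, w)] is not chosen, then [(w, u)] is, and so is the dart [(u, oth u w)] that follows
   it. *)
by have := none (oth u w); rewrite uw' O_oth // O_swap // nO.
Qed.

Let succ_uniq u v : F u v -> O (u, v) -> v = succ u.
Proof.
move=> uv Ouv; have /andP[uw Ouw] := succP uv.
have [_ _ H] := othP uv; apply/eqP/negPn/negP; rewrite eq_sym => /(H _ uw) E.
by move: Ouw; rewrite E O_oth 1?Fsym // O_swap // Ouv.
Qed.

Let succ_id u : (forall w, ~~ F u w) -> succ u = u.
Proof. by move=> nF; rewrite /succ; case: pickP => // w; rewrite (negbTE (nF w)). Qed.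

Let isolatedP u : (exists w, F u w) \/ (forall w, ~~ F u w).
Proof.
case: (pickP (F u)) => [w uw|none]; first by left; exists w.
by right=> w; rewrite none.
Qed.

Let succ_inj : injective succ.
Proof.
move=> u v suv; have [[u' uu']|nu] := isolatedP u; have [[v' vv']|nv] := isolatedP v.
- have /andP[us Ous] := succP uu'; have /andP[vs Ovs] := succP vv'.
  rewrite -suv in vs Ovs; apply/eqP/negPn/negP => uv.
  have [_ _ H] := othP (etrans (Fsym _ _) us).
  have := O_oth us; rewrite -(H v) 1?Fsym 1?eq_sym //.
  by rewrite (O_swap vs) Ovs Ous.
- have /andP[us _] := succP uu'.
  by move: us (nv u); rewrite suv (succ_id nv) Fsym => ->.
- have /andP[vs _] := succP vv'.
  by move: vs (nu v); rewrite -suv (succ_id nu) Fsym => ->.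
- by rewrite -(succ_id nu) suv succ_id.
Qed.

(** The permutation moves along the chosen direction. The sum in [nat] also says that [v == f u] and
    [u == f v] never hold together at a nonisolated [u], so that nontrivial cycles have length at
    least 3. *)
Lemma regular2_orientation :
  exists f : {perm T}, (forall u, (forall w, ~~ F u w) -> f u = u) /\
    forall u v w, F u w -> F u v = (v == f u) + (u == f v) :> nat.
Proof.
exists (perm succ_inj); split=> [u nu|u v w uw]; first by rewrite permE succ_id.
rewrite !permE; have /andP[us Ous] := succP uw.
case: (boolP (F u v)) => [uv|nuv].
  have vu : F v u by rewrite Fsym.
  case: (boolP (O (u, v))) => [Ouv|nOuv].
    rewrite -(succ_uniq uv Ouv) eqxx; case: eqP => // E.
    have /andP[_] := succP vu; rewrite -E => Ovu.
    by move: Ovu; rewrite O_swap // Ouv.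
  rewrite -(succ_uniq vu) ?eqxx ?(O_swap uv) //; case: eqP => // E.
  by rewrite E Ous in nOuv.
case: eqP => [E|_]; first by rewrite E us in nuv.
case: eqP => // E; have [[v' vv']|nv] := isolatedP v.
  have /andP[vs _] := succP vv'.
  by rewrite -E Fsym (negbTE nuv) in vs.
by rewrite succ_id // in E; rewrite E (negbTE (nv w)) in uw.
Qed.

End Orientation.

(** * Permutations with equal cyclic distances between marked points *)

Section MarkedOrbits.
Variables (T : finType) (Y : {set T}).
Implicit Types (f h : {perm T}) (m : nat) (r u v y z : T).

(** Both directions are allowed because a graph does not orient its cycles. *)
Definition same_marked_distances f h :=
  forall y z m, y \in Y -> z \in Y ->
    ((f ^+ m)%g y == z) || ((f ^+ m)%g z == y) =
    ((h ^+ m)%g y == z) || ((h ^+ m)%g z == y).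

Lemma permXV_eq f m u v : ((f^-1 ^+ m)%g u == v) = ((f ^+ m)%g v == u).
Proof. by rewrite expgVn -(inj_eq (@perm_inj _ (f ^+ m)%g)) permKV eq_sym. Qed.

Lemma same_marked_distancesV f h :
  same_marked_distances f h -> same_marked_distances f h^-1%g.
Proof. by move=> fh y z m yY zY; rewrite fh // !permXV_eq orbC. Qed.

Lemma marked_period f h r m :
  same_marked_distances f h -> r \in Y ->
  ((f ^+ m)%g r == r) = ((h ^+ m)%g r == r).
Proof. by move=> fh rY; have := fh r r m rY rY; rewrite !orbb. Qed.

Lemma marked_orbit_eq f h r k m :
  same_marked_distances f h -> r \in Y ->
  ((f ^+ k)%g r == (f ^+ m)%g r) = ((h ^+ k)%g r == (h ^+ m)%g r).
Proof.
move=> fh rY; wlog le_km : k m / k <= m => [hw|].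
  case/orP: (leq_total k m) => /hw // mk.
  by rewrite eq_sym mk eq_sym.
rewrite -(subnK le_km) !expgD !permM !(inj_eq perm_inj).
by rewrite eq_sym (marked_period _ fh rY) eq_sym.
Qed.

(* The two directions along the cycle of [h] through [r] differ only if some
   marked point of the cycle is neither [r] nor antipodal to it; such a point
   then selects the direction. *)
Lemma marked_orientation f h r :
  same_marked_distances f h -> r \in Y ->
  exists2 p, p = h \/ p = h^-1%g &
    forall m, (f ^+ m)%g r \in Y -> (p ^+ m)%g r = (f ^+ m)%g r.
Proof.
move=> fh rY.
have dist p : p = h \/ p = h^-1%g -> same_marked_distances f p.
  by case=> ->//; apply: same_marked_distancesV.
case: (pickP (fun i : 'I_#[f]%g =>
    ((f ^+ i)%g r \in Y) && ((f ^+ (i + i))%g r != r))) => [i /andP[iY nper]|none].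
- set y0 := (f ^+ i)%g r in iY.
  have [p hp pi] : exists2 p, p = h \/ p = h^-1%g & (p ^+ i)%g r = y0.
    have := fh r y0 i rY iY; rewrite eqxx => /esym/orP[/eqP|]; first by exists h; auto.
    by rewrite -permXV_eq => /eqP; exists h^-1%g; auto.
  exists p => // m; set y := (f ^+ m)%g r => yY.
  have fp := dist _ hp.
  have := fp r y m rY yY; rewrite eqxx => /esym/orP[/eqP//|/eqP pmy].
  (* [d] stands for [m - i] modulo the order of [f]. *)
  pose d := m + #[f]%g.-1 * i.
  have di : i + d = m + #[f]%g * i by rewrite /d addnCA -mulSn prednK ?order_gt0.
  have fd : (f ^+ d)%g y0 = y.
    by rewrite /y0 -permM -expgD di expgD expgM expg_order expg1n mulg1.
  have := fp y0 y d iY yY; rewrite fd eqxx => /esym/orP[/eqP pd|/eqP pd].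
    have per : (p ^+ (#[f]%g * i))%g r = r.
      by apply/eqP; rewrite -(marked_period _ fp rY) expgM expg_order expg1n perm1.
    by rewrite -pd -pi -permM -expgD di addnC expgD permM per.
  (* Here [p] leads from [r] to [y0] in [i] steps, and from [y] to [y0] in [m - i] and to [r] in [m]
     steps. So [i] steps lead from [y0] back to [r], against the choice of [i]. *)
  case/eqP: nper; apply/eqP; rewrite (marked_period _ fp rY).
  have per : (p ^+ (#[f]%g * i))%g r = r.
    by apply/eqP; rewrite -(marked_period _ fp rY) expgM expg_order expg1n perm1.
  by rewrite expgD permM pi -pd -permM -expgD addnC di expgD permM pmy per.
exists h; auto=> m; set y := (f ^+ m)%g r => yY.
have := fh r y m rY yY; rewrite eqxx => /esym/orP[/eqP//|/eqP hmy].
have /negbFE : ((f ^+ (m + m))%g r != r) = false.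
  have := none (Ordinal (ltn_pmod m (order_gt0 f))).
  by rewrite /= expgD permM expg_mod_order -permM -expgD yY.
by rewrite (marked_period _ fh rY) expgD permM -{2}hmy (inj_eq perm_inj) => /eqP.
Qed.

(** Every orbit of [f] gets a marked root. The point [m] steps of [f] after the root goes to the
    point [m] steps of [p] after it, where [p] is [h] or its inverse as [marked_orientation] selects
    for this root. *)
Lemma marked_perm_rel_iso f h :
  (forall u, exists2 r, r \in Y & r \in porbit f u) ->
  same_marked_distances f h ->
  exists2 s : {perm T}, {in Y, s =1 id} &
    forall u v, (s v == h (s u)) || (s u == h (s v)) = (v == f u) || (u == f v).
Proof.
move=> meetY fh.
(* The choice depends only on the orbit of [u], so all its points share one root; [meetY] ensures
   that the default is not reached. *)
pose rt u := odflt u [pick r in Y | porbit f r == porbit f u].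
have rtP u : rt u \in Y /\ porbit f (rt u) = porbit f u.
  rewrite /rt; case: pickP => [r /andP[rY /eqP]//|none].
  have [r rY ru] := meetY u; have := none r.
  by rewrite /= rY eq_porbit_mem ru.
have rt_eq u v : porbit f u = porbit f v -> rt u = rt v.
  move=> uv; rewrite /rt uv; case: pickP => // none.
  have [r rY ru] := meetY v; have := none r.
  by rewrite /= rY eq_porbit_mem ru.
have /fin_all_exists[p pP] : forall r, exists p : {perm T}, r \in Y ->
    (p = h \/ p = h^-1%g) /\ forall m, (f ^+ m)%g r \in Y -> (p ^+ m)%g r = (f ^+ m)%g r.
  move=> r; case: (boolP (r \in Y)) => [rY|_]; last by exists 1%g.
  by have [p ? ?] := marked_orientation fh rY; exists p.
have /fin_all_exists[e eP] : forall u, exists m, u = (f ^+ m)%g (rt u).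
  by move=> u; apply/porbitP; rewrite (rtP u).2 porbit_id.
pose s0 u := (p (rt u) ^+ e u)%g (rt u).
have pfh r : r \in Y -> same_marked_distances f (p r).
  by move=> rY; case: (pP r rY) => -[-> _|-> _] //; apply: same_marked_distancesV.
(* The exponent does not matter, since the root has the same period under [f] and [p (rt u)]. *)
have s0E u m : (f ^+ m)%g (rt u) = u -> s0 u = (p (rt u) ^+ m)%g (rt u).
  move=> fu; have rY := (rtP u).1; apply/eqP.
  by rewrite /s0 -(marked_orbit_eq _ _ (pfh _ rY) rY) fu -eP.
have s0_porbit u : porbit (p (rt u)) (s0 u) = porbit (p (rt u)) (rt u).
  by apply/eqP; rewrite eq_porbit_mem; apply/porbitP; exists (e u).
have porbit_p r u : r \in Y -> porbit (p r) u = porbit h u.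
  by move=> /pP[[-> //|->] _]; rewrite porbitV.
have s0_inj : injective s0.
  move=> u v suv.
  have [ruY pu] := rtP u; have [rvY pv] := rtP v.
  have /eqP : porbit h (rt u) = porbit h (rt v).
    by rewrite -(porbit_p _ _ ruY) -s0_porbit suv porbit_p //
       -(porbit_p _ _ rvY) s0_porbit porbit_p.
  rewrite eq_sym eq_porbit_mem => /porbitP[m rvm].
  (* Roots on one orbit of [h] are some [m] steps apart, hence also [m] steps apart under [f], so
     they belong to one orbit of [f]. *)
  have ruv : rt u = rt v.
    apply: rt_eq; rewrite -pu -pv; apply/eqP.
    have := fh (rt u) (rt v) m ruY rvY; rewrite -rvm eqxx => /orP[]/eqP E.
      by rewrite eq_sym eq_porbit_mem; apply/porbitP; exists m.
    by rewrite eq_porbit_mem; apply/porbitP; exists m.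
  move: suv; rewrite /s0 -ruv => /eqP.
  by rewrite -(marked_orbit_eq _ _ (pfh _ ruY) ruY) {2}ruv -!eP => /eqP.
have sf u : s0 (f u) = p (rt u) (s0 u).
  have rE : rt (f u) = rt u.
    by apply: rt_eq; apply/eqP; rewrite eq_porbit_mem; apply/porbitP; exists 1; rewrite expg1.
  rewrite (s0E (f u) (e u).+1) ?rE ?expgSr ?permM -?eP //.
exists (perm s0_inj) => [y yY|u v].
  by rewrite permE /s0 (pP _ (rtP y).1).2 -eP.
rewrite !permE.
(* Replacing [h] by its inverse swaps the two disjuncts. *)
have -> : (s0 v == h (s0 u)) || (s0 u == h (s0 v)) =
          (s0 v == p (rt u) (s0 u)) || (s0 u == p (rt u) (s0 v)).
  case: (pP _ (rtP u).1) => -[->|-> _] //.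
  by rewrite orbC 2![_ == h^-1%g _]eq_sym !(canF_eq (permKV h)).
rewrite -sf (inj_eq s0_inj); congr (_ || _).
(* Since [v] may have another root, [u == f v] is handled by stepping back from [u]. *)
have rE : rt (f^-1%g u) = rt u.
  apply: rt_eq; apply/eqP; rewrite eq_sym eq_porbit_mem.
  by apply/porbitP; exists 1; rewrite expg1 permKV.
have su : s0 u = p (rt u) (s0 (f^-1%g u)) by rewrite -rE -sf permKV.
by rewrite su (inj_eq perm_inj) (inj_eq s0_inj) -(inj_eq (@perm_inj _ f)) permKV.
Qed.

End MarkedOrbits.

Lemma perm_fixC_mem (T : finType) (P : {set T}) (f : {perm T}) :
  (forall u, u \notin P -> f u = u) -> forall u, (f u \in P) = (u \in P).
Proof.
move=> fP u; apply/idP/idP => uP; apply/negPn/negP => nP.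
  by move: (nP); rewrite -(fP _ nP) uP.
by move: (nP); rewrite (perm_inj (fP _ nP)) uP.
Qed.

(** * Chebyshev polynomials of a union of cycles *)

Local Open Scope ring_scope.

Section Chebyshev.
Variables (R : comPzRingType) (n : nat).
Implicit Types (A E M : 'M[R]_n) (P : {set 'I_n}) (f : 'S_n).

Definition indic_mx P : 'M[R]_n := diag_mx (\row_i (i \in P)%:R).

Lemma indic_mulE P m (B : 'M[R]_(n, m)) u v :
  (indic_mx P *m B) u v = (u \in P)%:R * B u v.
Proof. by rewrite mul_diag_mx !mxE. Qed.

Lemma mul_indicE P m (B : 'M[R]_(m, n)) u v :
  (B *m indic_mx P) u v = B u v * (v \in P)%:R.
Proof. by rewrite mul_mx_diag !mxE. Qed.

(* Up to rescaling these are the Chebyshev polynomials of the first kind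
   evaluated at [A], with [E] in place of the identity. *)
Fixpoint chebyshev_mx E A m : 'M[R]_n :=
  match m with
  | 0 => E *+ 2
  | S m1 => match m1 with
            | 0 => A
            | S m2 => A *m chebyshev_mx E A m1 - chebyshev_mx E A m2
            end
  end.

(** Orthogonal conjugation respects products and fixes [E]. The recurrence reaches back two indices,
    hence the induction on consecutive pairs. *)
Lemma chebyshev_mx_conj E A M m : M *m M^T = 1%:M -> M^T *m E *m M = E ->
  chebyshev_mx E (M^T *m A *m M) m = M^T *m chebyshev_mx E A m *m M.
Proof.
move=> MMt MEM.
suff [] : chebyshev_mx E (M^T *m A *m M) m = M^T *m chebyshev_mx E A m *m M /\
          chebyshev_mx E (M^T *m A *m M) m.+1 = M^T *m chebyshev_mx E A m.+1 *m M by [].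
elim: m => [|m [IH0 IH1]]; first by rewrite /= !mulr2n mulmxDr mulmxDl MEM.
split=> //.
have step B : chebyshev_mx E B m.+2 =
    B *m chebyshev_mx E B m.+1 - chebyshev_mx E B m by [].
rewrite !step IH0 IH1 mulmxBr mulmxBl; congr (_ - _).
by rewrite !mulmxA -[_ *m M *m M^T]mulmxA MMt mulmx1.
Qed.

Lemma sum_pred1_mul (T : finType) (x : T) (G : T -> R) :
  \sum_w (w == x)%:R * G w = G x.
Proof.
rewrite (bigD1 x) //= eqxx mul1r big1 ?addr0 // => w /negbTE->.
by rewrite mul0r.
Qed.

(** On [P] the matrix acts as [f + f^-1], and multiplying [f^(m+1) + f^-(m+1)] by it gives the terms
    of index [m + 2] and [m]. *)
Lemma chebyshev_mx_cycles f P A m :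
  (forall u, u \notin P -> f u = u) ->
  (forall u v, A u v = (u \in P)%:R * ((v == f u)%:R + (u == f v)%:R)) ->
  forall u v, chebyshev_mx (indic_mx P) A m u v =
    (u \in P)%:R * ((v == (f ^+ m)%g u)%:R + (u == (f ^+ m)%g v)%:R).
Proof.
move=> fP AE.
have fPE := perm_fixC_mem fP.
have fVPE u : (f^-1%g u \in P) = (u \in P) by rewrite -fPE permKV.
have AmulE (B : 'M[R]_n) u v :
    (A *m B) u v = (u \in P)%:R * (B (f u) v + B (f^-1%g u) v).
  rewrite mxE (eq_bigr (fun w => (u \in P)%:R * ((w == f u)%:R * B w v) +
     (u \in P)%:R * ((w == f^-1%g u)%:R * B w v))) => [|w _].
    by rewrite big_split /= -!mulr_sumr !sum_pred1_mul mulrDr.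
  by rewrite AE [w == f^-1%g u]eq_sym (canF_eq (permKV f)) mulrDr mulrDl !mulrA.
suff H u v : (chebyshev_mx (indic_mx P) A m u v =
    (u \in P)%:R * ((v == (f ^+ m)%g u)%:R + (u == (f ^+ m)%g v)%:R)) /\
   (chebyshev_mx (indic_mx P) A m.+1 u v =
    (u \in P)%:R * ((v == (f ^+ m.+1)%g u)%:R + (u == (f ^+ m.+1)%g v)%:R)).
  by move=> u v; have [] := H u v.
elim: m u v => [|m IH] u v.
  rewrite /= AE !expg0 !expg1 !perm1 !mxE; split=> //.
  case: (eqVneq u v) => [->|uv]; rewrite ?eqxx ?(negbTE uv).
    by rewrite mulr1n mulrDr mulr1.
  by rewrite mulr0n !addr0 mulr0.
split; first exact: (IH u v).2.
have -> : chebyshev_mx (indic_mx P) A m.+2 =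
  A *m chebyshev_mx (indic_mx P) A m.+1 - chebyshev_mx (indic_mx P) A m by [].
rewrite mxE AmulE [X in _ + X]mxE !(IH _ _).2 (IH _ _).1 fPE fVPE.
have E1 : (f u == (f ^+ m.+1)%g v) = (u == (f ^+ m)%g v).
  by rewrite expgSr permM (inj_eq perm_inj).
have E2 : (f^-1%g u == (f ^+ m.+1)%g v) = (u == (f ^+ m.+2)%g v).
  by rewrite [in RHS]expgSr permM (canF_eq (permKV f)).
have E3 : (f ^+ m.+1)%g (f u) = (f ^+ m.+2)%g u by rewrite [in RHS]expgS permM.
have E4 : (f ^+ m.+1)%g (f^-1%g u) = (f ^+ m)%g u by rewrite expgS permM permKV.
rewrite E1 E2 E3 E4; case: (u \in P); rewrite ?mul0r ?subr0 // !mul1r.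
by ring.
Qed.

End Chebyshev.

(** * Two-regularity under orthogonal conjugation *)

Section RegularTransfer.
Variables (R : realFieldType) (n : nat).
Implicit Types (A M : 'M[R]_n) (P : {set 'I_n}).

(* With [v = M 1_P], the quadratic form [sum A_uw (v_u - v_w)^2] vanishes, so
   [v] is an eigenvector of [A] for the eigenvalue 2 and [1_P] one of [A']. *)
Lemma regular_transfer A A' M P :
  M *m M^T = 1%:M -> A' = M^T *m A *m M -> M *m indic_mx R P = indic_mx R P *m M ->
  A^T = A -> A'^T = A' ->
  (forall u w, A u w * A u w = A u w) -> (forall u w, A' u w * A' u w = A' u w) ->
  (forall u, \sum_w A u w = 2 * (u \in P)%:R) ->
  forall u, \sum_w A' u w = 2 * (u \in P)%:R.
Proof.
move=> MMt A'E MP At A't Aid A'id Adeg.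
have MtM : M^T *m M = 1%:M by apply: mulmx1C.
have Age0 u w : 0 <= A u w by rewrite -Aid -expr2 sqr_ge0.
pose IP := indic_mx R P.
have IPt : IP^T = IP by apply: tr_diag_mx.
have MtP : M^T *m IP = IP *m M^T.
  by apply: trmx_inj; rewrite !trmx_mul trmxK IPt MP.
have PA : IP *m A = A.
  apply/matrixP => u w; rewrite indic_mulE; case: (boolP (u \in P)) => uP; first by rewrite mul1r.
  have := Adeg u; rewrite (negbTE uP) mulr0 mul0r => /eqP.
  by rewrite psumr_eq0 // => /allP/(_ w); rewrite mem_index_enum => /(_ isT)/eqP.
have AP : A *m IP = A by apply: trmx_inj; rewrite trmx_mul IPt At PA.
have A'P : A' *m IP = A' by rewrite A'E -!mulmxA MP mulmxA -/IP !mulmxA -(mulmxA _ A) AP.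
have PA' : IP *m A' = A' by apply: trmx_inj; rewrite trmx_mul IPt A't A'P.
pose j : 'cV[R]_n := const_mx 1; pose jP := IP *m j; pose v := M *m jP.
have AjE (B : 'M[R]_n) u : (B *m j) u 0 = \sum_w B u w.
  by rewrite mxE; apply: eq_bigr => w _; rewrite mxE mulr1.
have jBj (B : 'M[R]_n) : (j^T *m B *m j) 0 0 = \sum_u \sum_w B u w.
  rewrite -mulmxA mxE; apply: eq_bigr => u _.
  by rewrite AjE !mxE mul1r.
have vv : \sum_u v u 0 ^+ 2 = \sum_u (u \in P)%:R.
  transitivity ((v^T *m v) 0 0).
    by rewrite mxE; apply: eq_bigr => u _; rewrite !mxE expr2.
  rewrite /v trmx_mul mulmxA -(mulmxA _ M^T) MtM mulmx1 mxE.
  by apply: eq_bigr => u _; rewrite mxE indic_mulE mxE mulr1 -natrM mulnb andbb.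
(* When the entries are idempotent, their sum is the squared Frobenius norm, which orthogonal
   conjugation preserves. *)
have sumsq (B : 'M[R]_n) : (forall u w, B u w * B u w = B u w) ->
    \tr (B^T *m B) = \sum_u \sum_w B u w.
  move=> Bid; rewrite /mxtrace exchange_big; apply: eq_bigr => u _.
  by rewrite mxE; apply: eq_bigr => w _; rewrite !mxE Bid.
have sumA' : \sum_u \sum_w A' u w = 2 * \sum_u (u \in P)%:R.
  rewrite -sumsq // A'E !trmx_mul trmxK !mulmxA -(mulmxA _ M) MMt mulmx1.
  rewrite -!mulmxA mxtrace_mulC -!mulmxA MMt mulmx1 sumsq // mulr_sumr.
  by apply: eq_bigr => u _; rewrite Adeg.
have vAv : \sum_u \sum_w A u w * (v u 0 * v w 0) = 2 * \sum_u (u \in P)%:R.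
  rewrite -sumA' -jBj -PA' -A'P A'E.
  transitivity ((v^T *m (A *m v)) 0 0).
    rewrite mxE; apply: eq_bigr => u _; rewrite [v^T 0 u]mxE [(A *m v) u 0]mxE mulr_sumr.
    by apply: eq_bigr => w _; ring.
  by congr (fun_of_matrix _ 0 0); rewrite /v /jP !trmx_mul IPt !mulmxA.
(* After expansion, each of the two sums of squares is at most [2 * #|P|], while the mixed sum
   equals [2 * #|P|] and is subtracted twice. *)
have vzero : \sum_u \sum_w A u w * (v u 0 - v w 0) ^+ 2 <= 0.
  have -> : \sum_u \sum_w A u w * (v u 0 - v w 0) ^+ 2 =
     \sum_u \sum_w A u w * v u 0 ^+ 2 + \sum_u \sum_w A u w * v w 0 ^+ 2
     - 2 * \sum_u \sum_w A u w * (v u 0 * v w 0).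
    rewrite mulr_sumr -big_split -sumrB /=; apply: eq_bigr => u _.
    rewrite mulr_sumr -big_split -sumrB /=; apply: eq_bigr => w _; ring.
  have H : \sum_u \sum_w A u w * v u 0 ^+ 2 <= 2 * \sum_u (u \in P)%:R.
    rewrite -vv mulr_sumr; apply: ler_sum => u _.
    rewrite -mulr_suml Adeg ler_wpM2r ?sqr_ge0 //.
    by case: (u \in P); rewrite ?mulr1 ?mulr0.
  have -> : \sum_u \sum_w A u w * v w 0 ^+ 2 = \sum_u \sum_w A u w * v u 0 ^+ 2.
    rewrite exchange_big; apply: eq_bigr => u _; apply: eq_bigr => w _.
    by rewrite -[in LHS]At mxE.
  by rewrite vAv; lra.
have edge u w : A u w * v w 0 = A u w * v u 0.
  have ge0 a b : 0 <= A a b * (v a 0 - v b 0) ^+ 2 by rewrite mulr_ge0 ?sqr_ge0.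
  have : A u w * (v u 0 - v w 0) ^+ 2 = 0.
    have : \sum_u \sum_w A u w * (v u 0 - v w 0) ^+ 2 == 0.
      by rewrite eq_le vzero sumr_ge0 // => a _; apply: sumr_ge0.
    rewrite psumr_eq0 => [|a _]; last exact: sumr_ge0.
    move=> /allP/(_ u); rewrite mem_index_enum => /(_ isT) /=.
    by rewrite psumr_eq0 // => /allP/(_ w); rewrite mem_index_enum => /(_ isT)/eqP.
  move/eqP; rewrite mulf_eq0 sqrf_eq0 subr_eq0 => /orP[]/eqP->//.
  by rewrite !mul0r.
have Av : A *m v = 2 *: v.
  have vP : IP *m v = v.
    rewrite /v mulmxA -MP -mulmxA; congr (_ *m _); apply/matrixP => u w.
    by rewrite !indic_mulE mulrA -natrM mulnb andbb.
  apply/matrixP => u w; rewrite ord1 mxE (eq_bigr _ (fun w _ => edge u w)).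
  by rewrite -mulr_suml Adeg [RHS]mxE -[in RHS]vP indic_mulE mulrA.
move=> u; rewrite -AjE -A'P -mulmxA -/jP A'E -!mulmxA -/v Av.
by rewrite -scalemxAr /v mulmxA MtM mul1mx mxE indic_mulE mxE mulr1.
Qed.

End RegularTransfer.

(** * Switching *)

Section SwitchingMatrix.
Variables (R : realType) (n k : nat) (Q : 'M[R]_k) (e : 'I_k -> 'I_n) (s : 'I_n -> bool).
Hypothesis e_inj : injective e.
Let X := [set e i | i in 'I_k].
Let M := switch_mx Q e s.

Lemma switch_mx_in i j : M (e i) (e j) = Q i j.
Proof.
rewrite mxE; case: pickP => [i' /eqP/e_inj->|/(_ i)]; last by rewrite eqxx.
by case: pickP => [j' /eqP/e_inj->|/(_ j)] //; rewrite eqxx.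
Qed.

Lemma switch_mx_out u v : ~~ ((u \in X) && (v \in X)) ->
  M u v = (u == v)%:R * (-1) ^+ s u.
Proof.
have XE w i : e i == w -> w \in X by move=> /eqP <-; apply: imset_f.
rewrite mxE; case: pickP => [i /XE uX|nu]; case: pickP => [j /XE vX|nv].
- by rewrite uX vX.
- move=> _; case: eqP => [uv|_]; last by rewrite mul0r.
  by move: uX; rewrite uv => /imsetP[j _ vj]; have := nv j; rewrite vj eqxx.
- move=> _; case: eqP => [uv|_]; last by rewrite mul0r.
  by move: vX; rewrite -uv => /imsetP[i _ vi]; have := nu i; rewrite vi eqxx.
by move=> _; case: eqP => _; rewrite ?mul0r // mul1r; case: (s u).
Qed.

Lemma switch_mx_orthogonal : orthogonal_mx Q -> M *m M^T = 1%:M.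
Proof.
move=> Qorth; apply/matrixP => u v; rewrite [LHS]mxE [RHS]mxE.
have out a b : a \notin X -> \sum_w M a w * M^T w b = (a == b)%:R.
  move=> aX; rewrite (bigD1 a) //= big1 ?addr0 => [|w wa]; last first.
    by rewrite switch_mx_out ?(negbTE aX) // eq_sym (negbTE wa) !mul0r.
  rewrite [M^T _ _]mxE !switch_mx_out ?(negbTE aX) ?andbF // eqxx mul1r mulrCA eq_sym.
  by case: eqP => [->|]; rewrite ?mul0r // mul1r -expr2 sqrr_sign.
have [uX|/out//] := boolP (u \in X); have [vX|/out vX] := boolP (v \in X); last first.
  by rewrite eq_sym -vX; apply: eq_bigr => w _; rewrite ![M^T _ _]mxE mulrC.
case/imsetP: uX vX => i _ -> /imsetP[j _ ->].
rewrite (bigID (mem X)) /= [X in _ + X]big1 ?addr0 => [|w wX]; last first.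
  rewrite switch_mx_out ?(negbTE wX) ?andbF //; case: eqP => [E|]; last by rewrite !mul0r.
  by move: wX; rewrite -E imset_f.
rewrite big_imset /= => [|a b _ _ /e_inj//].
under eq_bigr do rewrite [M^T _ _]mxE !switch_mx_in.
move/matrixP/(_ i j): Qorth; rewrite !mxE (inj_eq e_inj) => <-.
by apply: eq_bigr => a _; rewrite mxE.
Qed.

End SwitchingMatrix.

Definition touching (n : nat) (X : {set 'I_n}) (g : rel 'I_n) : rel 'I_n :=
  fun u v => g u v && ((u \in X) || (v \in X)).

Section Switching.
Variables (R : realType) (n : nat) (g h : rel 'I_n) (X : {set 'I_n}).
Variables (M : 'M[R]_n) (s : 'I_n -> bool).
Hypotheses (gsym : symmetric g) (girr : irreflexive g).
Hypotheses (hsym : symmetric h) (hirr : irreflexive h).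
Hypothesis M_orth : M *m M^T = 1%:M.
Hypothesis M_out : forall u v, ~~ ((u \in X) && (v \in X)) ->
  M u v = (u == v)%:R * (-1) ^+ s u.
Hypothesis gh : adjmx R h = M^T *m adjmx R g *m M.

Let F := touching X g.
Let F' := touching X h.

Lemma touching_sym (f : rel 'I_n) : symmetric f -> symmetric (touching X f).
Proof. by move=> fsym u v; rewrite /touching fsym orbC. Qed.

Lemma touching_irr (f : rel 'I_n) : irreflexive f -> irreflexive (touching X f).
Proof. by move=> firr u; rewrite /touching firr. Qed.

(** [M] is block diagonal with [X] and the single vertices outside it as blocks, and the indicator
    is constant on each block. *)
Lemma switching_indic_comm (P : {set 'I_n}) :
  {in X &, forall u v, (u \in P) = (v \in P)} ->
  M *m indic_mx R P = indic_mx R P *m M.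
Proof.
move=> XP; apply/matrixP => u v; rewrite indic_mulE mul_indicE mulrC.
have [/andP[uX vX]|/M_out->] := boolP ((u \in X) && (v \in X)); first by rewrite (XP u v).
by case: eqP => [->//|]; rewrite !mul0r !mulr0.
Qed.

Lemma switching_out (B : 'M[R]_n) u v : u \notin X -> v \notin X ->
  (M^T *m B *m M) u v = (-1) ^+ s u * (-1) ^+ s v * B u v.
Proof.
have outM (C : 'M[R]_n) a b : b \notin X -> (C *m M) a b = (-1) ^+ s b * C a b.
  move=> bX; rewrite mxE (bigD1 b) //= big1 ?addr0 => [|w /negbTE wb].
    by rewrite M_out ?(negbTE bX) ?andbF // eqxx mul1r mulrC.
  by rewrite M_out ?(negbTE bX) ?andbF // wb mul0r mulr0.
move=> uX vX; rewrite outM // -[M^T *m B]trmxK trmx_mul trmxK mxE outM // mxE.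
by rewrite mulrA [_ ^+ s v * _]mulrC.
Qed.

(** The entries are natural numbers, so absolute values remove the signs. *)
Lemma switching_out_nat (A B : 'M[R]_n) (a b : nat) u v :
  u \notin X -> v \notin X -> B = M^T *m A *m M ->
  A u v = a%:R -> B u v = b%:R -> a = b.
Proof.
move=> uX vX -> Aa; rewrite switching_out // Aa -signr_addb => /(congr1 Num.norm).
by rewrite normrMsign !normr_nat => /eqP; rewrite eqr_nat => /eqP.
Qed.

Lemma switching_adj_out u v : u \notin X -> v \notin X -> h u v = g u v.
Proof.
move=> uX vX; have := switching_out_nat uX vX gh (mxE _ _ _ _) (mxE _ _ _ _).
by case: (g u v); case: (h u v).
Qed.

(** The edges avoiding [X] have matrix [D A D], with [D] the indicator of the complement of [X]. As
    [D] commutes with [M], this part is conjugated by itself and can be subtracted. *)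
Lemma switching_touching : adjmx R F' = M^T *m adjmx R F *m M.
Proof.
have touchE (f : rel 'I_n) : adjmx R (touching X f) =
    adjmx R f - indic_mx R (~: X) *m adjmx R f *m indic_mx R (~: X).
  apply/matrixP => u v; rewrite mxE [RHS]mxE [X in _ + X]mxE mul_indicE indic_mulE !mxE !inE.
  by rewrite /touching; case: (f u v); case: (u \in X); case: (v \in X);
    rewrite /= ?mul0r ?mulr0 ?mul1r ?mulr1 ?subr0 ?subrr.
have comm : M *m indic_mx R (~: X) = indic_mx R (~: X) *m M.
  by apply: switching_indic_comm => u v uX vX; rewrite !inE uX vX.
have commT : M^T *m indic_mx R (~: X) = indic_mx R (~: X) *m M^T.
  apply: trmx_inj; rewrite !trmx_mul trmxK.
  by rewrite (_ : (indic_mx R (~: X))^T = indic_mx R (~: X)) ?comm //; apply: tr_diag_mx.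
rewrite /F /F' !touchE mulmxBr mulmxBl -gh; congr (_ - _).
by rewrite gh !mulmxA commT -!mulmxA comm.
Qed.

Lemma switching_nonintegral_deg :
  (forall x, x \in X -> ~ forall v, exists z : int, M x v = z%:~R) ->
  forall y, y \notin X -> (0 < deg_in g X y)%N -> (2 <= deg_in g X y)%N.
Proof.
move=> nonint y yX; rewrite leq_eqVlt => /orP[|//].
rewrite eq_sym deg_inE => /cards1P[x Ex].
(* Passing from [g] to [F] drops the neighbours of [y] outside [X], so row [y] becomes the unit row
   at [x]. *)
have nE w : F y w = (w == x).
  by rewrite /F /touching (negbTE yX) /= andbC; move/setP/(_ w): Ex; rewrite !inE.
have xX : x \in X by have := nE x; rewrite eqxx /F /touching (negbTE yX) => /andP[].
case: (nonint x xX) => v; exists ((-1) ^+ s y * (F' y v : nat)%:Z).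
have : adjmx R F' y v = (-1) ^+ s y * M x v.
  rewrite switching_touching -mulmxA mxE (bigD1 y) //= big1 ?addr0 => [|w /negbTE wy].
    rewrite mxE M_out ?(negbTE yX) // eqxx mul1r; congr (_ * _).
    rewrite mxE -[RHS](@sum_pred1_mul R _ x (M^~ v)); apply: eq_bigr => w _.
    by rewrite mxE nE.
  by rewrite mxE M_out ?(negbTE yX) ?andbF // wy !mul0r.
rewrite mxE rmorphM rmorph_sign /= -pmulrn => ->.
by rewrite mulrA -expr2 sqrr_sign mul1r.
Qed.

Hypothesis degX : forall x, x \in X -> deg_in g [set: 'I_n] x = 2.
Hypothesis degY : forall y, y \notin X -> (0 < deg_in g X y)%N -> deg_in g X y = 2.
Hypothesis gconn : connected_graph g.

Let P := [set u | [exists w, F u w]].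

Let adj_sum (f : rel 'I_n) u :
  \sum_w adjmx R f u w = (deg_in f [set: 'I_n] u)%:R.
Proof.
by rewrite natr_sum; apply: eq_big => [w|w _]; rewrite ?inE ?mxE.
Qed.

Let F_sum u : \sum_w adjmx R F u w = 2 * (u \in P)%:R.
Proof.
have PE : (u \in P) = (0 < deg_in F [set: 'I_n] u)%N.
  by rewrite inE; apply/existsP/deg_in_gt0P => [[w]|[w _]]; exists w.
rewrite adj_sum PE; have [uX|uX] := boolP (u \in X).
  suff -> : deg_in F [set: 'I_n] u = 2 by rewrite mulr1.
  by rewrite -(degX uX); apply: eq_bigr => w _; rewrite /F /touching uX andbT.
have -> : deg_in F [set: 'I_n] u = deg_in g X u.
  rewrite !deg_inE; apply: eq_card => w; rewrite !inE.
  by rewrite /F /touching (negbTE uX) /= andbC.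
by case: posnP => [->|/(degY uX)->]; rewrite ?mulr0 ?mulr1.
Qed.

Let subXP u : u \in X -> u \in P.
Proof.
move=> uX; have := F_sum u; rewrite adj_sum; case: (u \in P) => //.
rewrite mulr0 => /eqP; rewrite pnatr_eq0.
have -> : deg_in F [set: 'I_n] u = 2.
  by rewrite -(degX uX); apply: eq_bigr => w _; rewrite /F /touching uX andbT.
by [].
Qed.

Let P_comm : M *m indic_mx R P = indic_mx R P *m M.
Proof. by apply: switching_indic_comm => u v /subXP-> /subXP->. Qed.

Let adj_tr (f : rel 'I_n) : symmetric f -> (adjmx R f)^T = adjmx R f.
Proof. by move=> fsym; apply/matrixP => u v; rewrite !mxE fsym. Qed.

Let adj_idem (f : rel 'I_n) u w : adjmx R f u w * adjmx R f u w = adjmx R f u w.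
Proof. by rewrite mxE -natrM mulnb andbb. Qed.

Let F'_sum u : \sum_w adjmx R F' u w = 2 * (u \in P)%:R.
Proof.
exact: (regular_transfer M_orth switching_touching P_comm (adj_tr (touching_sym gsym))
  (adj_tr (touching_sym hsym)) (@adj_idem _) (@adj_idem _) F_sum).
Qed.

Let cycles_exist (f : rel 'I_n) : symmetric f -> irreflexive f ->
  (forall u, \sum_w adjmx R f u w = 2 * (u \in P)%:R) ->
  exists p : {perm 'I_n}, (forall u, u \notin P -> p u = u) /\
    forall u v, adjmx R f u v = (u \in P)%:R * ((v == p u)%:R + (u == p v)%:R).
Proof.
move=> fsym firr fsum.
have fdeg u : deg_in f [set: 'I_n] u = (2 * (u \in P))%N.
  by apply/eqP; rewrite -(eqr_nat R) -adj_sum fsum natrM.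
have fP u w : f u w -> u \in P.
  move=> uw; have := deg_in_gt0 (in_setT w) uw; rewrite fdeg.
  by case: (u \in P).
have [|p [pid pE]] := regular2_orientation fsym firr.
  move=> u v uv; have := fdeg u; rewrite (fP _ _ uv) deg_inE muln1 => <-.
  by apply: eq_card => w; rewrite !inE.
exists p; split=> [u uP|u v].
  by apply: pid => w; apply: contra uP; apply: fP.
rewrite mxE; case: (boolP (u \in P)) => uP; last first.
  by rewrite mul0r; case: (boolP (f u v)) => // /fP; rewrite (negbTE uP).
have : (0 < deg_in f [set: 'I_n] u)%N by rewrite fdeg uP.
by case/deg_in_gt0P => w _ uw; rewrite mul1r (pE _ _ _ uw) natrD.
Qed.

Lemma switching_iso : graph_iso g h.
Proof.
have Fsym := touching_sym gsym; have Firr := touching_irr girr.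
have F'sym := touching_sym hsym; have F'irr := touching_irr hirr.
have [p [pid pE]] := cycles_exist Fsym Firr F_sum.
have [q [qid qE]] := cycles_exist F'sym F'irr F'_sum.
have PMP : M^T *m indic_mx R P *m M = indic_mx R P.
  by rewrite -mulmxA -P_comm mulmxA (mulmx1C M_orth) mul1mx.
have chebE m : chebyshev_mx (indic_mx R P) (adjmx R F') m =
    M^T *m chebyshev_mx (indic_mx R P) (adjmx R F) m *m M.
  by rewrite switching_touching chebyshev_mx_conj.
have cyc_fixP (f : 'S_n) m u : (forall w, w \notin P -> f w = w) -> u \notin P ->
    (f ^+ m)%g u = u.
  move=> fid uP; elim: m => [|m IHm]; first by rewrite expg0 perm1.
  by rewrite expgS permM fid.
have relE (f : rel 'I_n) (t : 'S_n) u v :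
    (forall u v, adjmx R f u v = (u \in P)%:R * ((v == t u)%:R + (u == t v)%:R)) ->
    f u v = (u \in P) && ((v == t u) || (u == t v)).
  move=> /(_ u v); rewrite mxE -natrD -natrM => /eqP; rewrite eqr_nat => /eqP.
  by case: (f u v); case: (u \in P); case: (v == _); case: (u == _).
(* It is enough that [t] carries the cycles of [F] to those of [F'] and fixes every vertex outside
   [X]: the edges avoiding [X] are the same in [g] and [h]. *)
have [t tid tE] : exists2 t : 'S_n, {in ~: X, t =1 id} &
    forall u v, (t v == q (t u)) || (t u == q (t v)) = (v == p u) || (u == p v).
  have [/forallP meetY|/forallPn[v0 v0X]] := boolP [forall u, [exists r in ~: X, r \in porbit p u]].
    apply: marked_perm_rel_iso => [u|]; first by have /exists_inP := meetY u.
    move=> y z m; rewrite !inE => yX zX.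
    have [yP|yP] := boolP (y \in P); last first.
      rewrite !(cyc_fixP _ _ y) //; congr (_ || _).
      by rewrite -[in RHS](cyc_fixP q m y) // -[in LHS](cyc_fixP p m y) // !(inj_eq perm_inj).
    have := @switching_out_nat _ _ _ _ y z yX zX (chebE m).
    rewrite (chebyshev_mx_cycles _ pid pE) (chebyshev_mx_cycles _ qid qE) yP !mul1r -!natrD.
    move=> /(_ _ _ erefl erefl); rewrite !(eq_sym z) !(eq_sym y).
    by do 4 case: (_ == _).
  (* The orbit of [v0] lies inside [X], so every edge of [g] at the orbit belongs to [F] and stays
     on it. By connectivity the orbit contains all vertices. *)
  have v0sub r : r \in porbit p v0 -> r \in X.
    move=> rv; apply/negPn/negP => rX; case/negP: v0X; apply/exists_inP.
    by exists r; rewrite ?inE.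
  have pw w : porbit p (p w) = porbit p w.
    by apply/eqP; rewrite eq_porbit_mem; apply/porbitP; exists 1%N; rewrite expg1.
  have orbT u : u \in porbit p v0.
    have cl : closed g (mem (porbit p v0)).
      apply: intro_closed => [|a b ab aO]; first exact: sym_connect_sym.
      have : F a b by rewrite /F /touching ab v0sub.
      rewrite (relE F p _ _ pE) => /andP[_ /orP[]/eqP E].
        by rewrite E -eq_porbit_mem pw eq_porbit_mem.
      by rewrite -eq_porbit_mem -pw -E eq_porbit_mem.
    by rewrite -(closed_connect cl (gconn v0 u)) porbit_id.
  have XT u : u \in X by apply: v0sub.
  have PT u : u \in P by apply: subXP.
  (* With no vertex outside [X], marking [v0] alone suffices; it remains to see that [p ^+ m] and
     [q ^+ m] fix [v0] for the same [m]. *)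
  have [||t tv tE] := @marked_perm_rel_iso _ [set v0] p q; last first.
  - by exists t => // u; rewrite !inE XT.
  - move=> y z m /set1P-> /set1P->; rewrite !orbb.
    have trE (f : 'S_n) (A : 'M[R]_n) : (forall u, u \notin P -> f u = u) ->
        (forall u v, A u v = (u \in P)%:R * ((v == f u)%:R + (u == f v)%:R)) ->
        \tr (chebyshev_mx (indic_mx R P) A m) = (#|[set u | (f ^+ m)%g u == u]| * 2)%:R.
      move=> fid fE; rewrite -sum1dep_card big_mkcond big_distrl natr_sum.
      apply: eq_bigr => u _; rewrite (chebyshev_mx_cycles _ fid fE) PT eq_sym mul1r.
      rewrite -natrD addnn -muln2.
      by case: eqP.
    have : \tr (chebyshev_mx (indic_mx R P) (adjmx R F') m) =
           \tr (chebyshev_mx (indic_mx R P) (adjmx R F) m).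
      by rewrite chebE -mulmxA mxtrace_mulC -mulmxA M_orth mulmx1.
    rewrite (trE _ _ pid pE) (trE _ _ qid qE) => /eqP; rewrite eqr_nat eqn_pmul2r // => /eqP.
    (* As [p] is a single cycle, [p ^+ m] fixes all vertices or none, and by the traces [q ^+ m]
       fixes equally many. *)
    have pfix u : ((p ^+ m)%g u == u) = ((p ^+ m)%g v0 == v0).
      have /porbitP[i ->] := orbT u.
      by rewrite -!permM -expgD addnC expgD permM (inj_eq perm_inj).
    have [pv0|pv0] := boolP ((p ^+ m)%g v0 == v0).
      have -> : [set u | (p ^+ m)%g u == u] = setT by apply/setP => u; rewrite !inE pfix.
      move=> E; apply/esym; have /eqP/setP/(_ v0) : [set u | (q ^+ m)%g u == u] == setT.
        by rewrite eqEcard subsetT E /=.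
      by rewrite !inE.
    have -> : [set u | (p ^+ m)%g u == u] = set0.
      by apply/setP => u; rewrite !inE pfix (negbTE pv0).
    by rewrite cards0 => /eqP; rewrite cards_eq0 => /eqP/setP/(_ v0); rewrite !inE.
  by move=> u; exists v0; rewrite ?inE // porbit_sym.
have tX u : (t u \in X) = (u \in X).
  by apply: perm_fixC_mem => w wX; apply: tid; rewrite inE.
have tP u : (t u \in P) = (u \in P).
  apply: perm_fixC_mem => w wP; apply: tid; rewrite inE.
  by apply: contra wP; apply: subXP.
exists t => u v; have [uvX|uvX] := boolP ((u \in X) || (v \in X)).
  have : F' (t u) (t v) = F u v by rewrite (relE F' q _ _ qE) (relE F p _ _ pE) tP tE.
  by rewrite /F /F' /touching !tX uvX !andbT.
move: uvX; rewrite negb_or => /andP[uX vX].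
by rewrite !tid ?inE // switching_adj_out.
Qed.

End Switching.

Unset Implicit Arguments.
Set Strict Implicit.

Theorem theorem3p1 (R : realType) (n k : nat) (g : rel 'I_n) (Q : 'M[R]_k) :
  (k <= n)%N ->
  simple_graph g ->
  connected_graph g ->
  (forall v, (2 <= degree g v)%N) ->
  orthogonal_mx Q ->
  (forall i, ~ integral_row Q i) ->
  (exists h : rel 'I_n,
      simple_graph h /\ ~ graph_iso g h /\ Q_switching Q g h) ->
  exists (S : {set 'I_n}) (F : {set {set 'I_n}}),
    connected_subgraph g S F /\ (#|S| <= 2 * k + 1)%N /\ (#|S| < #|F|)%N.
Proof.
move=> _ [gsym girr] gconn mindeg Qorth Qnonint [h [[hsym hirr] [niso [e [s [e_inj gh]]]]]].
pose X := [set e i | i in 'I_k].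
have Morth := switch_mx_orthogonal s e_inj Qorth.
have Mout := @switch_mx_out _ _ _ Q e s.
have Xk : (#|X| <= k)%N by rewrite -[k in (_ <= k)%N]card_ord leq_imset_card.
have mindeg' v : (2 <= deg_in g [set: 'I_n] v)%N.
  apply: leq_trans (mindeg v) _; rewrite deg_inE.
  by apply/subset_leq_card/subsetP => u; rewrite !inE.
have degX : forall y, y \notin X -> (0 < deg_in g X y)%N -> (2 <= deg_in g X y)%N.
  apply: (switching_nonintegral_deg Mout gh) => _ /imsetP[i _ ->] int; apply: (Qnonint i) => j.
  by have [z] := int (e j); rewrite switch_mx_in //; exists z.
have local := dense_or_regular gsym girr mindeg' degX Xk.
(* A single vertex of [X] with a dense set suffices, so regularity may be assumed at all of them at
   once. *)
have [[S [S0 Sc dense Sk]]|sparse] : (exists S, [/\ S != set0, induced_connected g S,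
    (2 * #|S| < deg_sum g S)%N & (#|S| <= 2 * k + 1)%N]) \/
  forall x, x \in X -> deg_in g [set: 'I_n] x = 2 /\
    forall y, y \notin X -> g y x -> deg_in g X y = 2.
  have [/exists_inP[x xX nx]|/exists_inPn none] := boolP [exists x in X,
    ~~ ((deg_in g [set: 'I_n] x == 2) && [forall y in ~: X, g y x ==> (deg_in g X y == 2)])].
    have [dense|[dx dy]] := local x xX; [by left | case/negP: nx].
    rewrite dx eqxx; apply/forall_inP => y; rewrite inE => yX.
    by apply/implyP => yx; rewrite dy.
  right=> x /none; rewrite negbK => /andP[/eqP dx /forall_inP dy]; split=> // y yX yx.
  by have := dy y; rewrite inE yX yx => /(_ isT)/eqP.
  have [F [SF card]] := dense_connected_subgraph girr S0 Sc dense.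
  by exists S, F.
(* Regularity at every vertex of [X] would make [h] isomorphic to [g]. *)
case: niso; apply: (switching_iso gsym girr hsym hirr Morth Mout gh) => // [x /sparse[]//|y yX].
by move=> /deg_in_gt0P[x xX yx]; apply: (sparse x xX).2.
Qed.
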